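(* The homogeneous ideal in $\mathbb{C}[t_0,\ldots,t_5]$ of the image of the embedding of $\overline{M}_{0,5}$ into $\mathbb{P}^5$ via the $\kappa$ class is generated by the five quadrics $$t_0 t_1-t_0t_4+t_2 t_3-t_1 t_2,\quad t_0t_4-t_3 t_4+t_3 t_5-t_1t_5,\quad t_1t_3-t_0 t_4,\quad t_2t_3-t_0 t_5,\quad t_2 t_4-t_1t_5.$$
   Context: $\overline{M}_{0,5}$ is the moduli space (over $\mathbb{C}$) of stable $5$-pointed rational curves, and $\kappa=K_{\overline{M}_{0,5}}+\sum\delta_I$ is the sum of the canonical class and all boundary divisor classes, which is very ample. There is a closed embedding $\phi:\overline{M}_{0,5}\hookrightarrow\mathbb{P}^1_{[a_0:a_1]}\times\mathbb{P}^2_{[b_0:b_1:b_2]}$ given on the locus of distinct points $p_1,\ldots,p_5\in\mathbb{P}^1$ (in an affine coordinate) by $$[\mathbb{P}^1,p_1,\ldots,p_5]\mapsto\left(\left[\tfrac{p_1-p_2}{p_4-p_2}:\tfrac{p_1-p_3}{p_4-p_3}\right],\left[\tfrac{p_1-p_2}{p_5-p_2}:\tfrac{p_1-p_3}{p_5-p_3}:\tfrac{p_1-p_4}{p_5-p_4}\right]\right).$$ By Keel–Tevelev, the composition of $\phi$ with the Segre embedding $\mathbb{P}^1\times\mathbb{P}^2\hookrightarrow\mathbb{P}^5$ is the embedding of $\overline{M}_{0,5}$ by the complete linear system $|\kappa|$. The coordinates on $\mathbb{P}^5$ are the Segre coordinates $t_{3i+j}=a_ib_j$ for $i\in\{0,1\}$,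 $j\in\{0,1,2\}$. *)

(* Defs.v *)
(* MathComp; the complex numbers are R[i] for R : realType. *)
From mathcomp Require Import all_boot all_order all_algebra.
From mathcomp Require Import reals complex mpoly.

Set Implicit Arguments.
Unset Strict Implicit.
Unset Printing Implicit Defensive.

Import GRing.Theory.
Local Open Scope ring_scope.

(** Stable 5-pointed rational curves *)

(* A point of P^1 is given by nonzero homogeneous coordinates (x, y); the affine
   point x is (x, 1).  The bracket vanishes iff the points coincide, and it is
   the difference x - y on affine points. *)
Definition br (K : fieldType) (p q : K * K) : K := p.1 * q.2 - p.2 * q.1.

(* Any two vertices are joined by exactly one simple path. *)
Definition is_tree (V : finType) (e : rel V) : Prop :=
  forall x y : V, exists! p : seq V,
    [/\ path e x p, last x p = y & uniq (x :: p)].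

(* A nodal curve of arithmetic genus 0 is a tree of projective lines.  Adjacent
   components v, w are glued by identifying node v w, on the line v, with
   node w v, on the line w.  The marked point p_(k+1) has index k : 'I_5. *)
Record stable_curve (K : fieldType) := StableCurve {
  comp : finType;
  adj : rel comp;
  node : comp -> comp -> K * K;
  on : 'I_5 -> comp;
  pt : 'I_5 -> K * K;
  adj_sym : ssrbool.symmetric adj;
  adj_irr : irreflexive adj;
  adj_tree : is_tree adj;
  pt_neq0 : forall i, pt i != (0, 0);
  node_neq0 : forall v w, adj v w -> node v w != (0, 0);
  pt_pt : forall i j, i != j -> on i = on j -> br (pt i) (pt j) != 0;
  pt_node : forall i w, adj (on i) w -> br (pt i) (node (on i) w) != 0;
  node_node : forall v w w', adj v w -> adj v w' -> w != w' ->
    br (node v w) (node v w') != 0;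
  stable : forall v, (3 <= #|[set i | on i == v]| + #|[set w | adj v w]|)%N
}.

Section Embedding.
Variables (K : fieldType) (C : stable_curve K).

(* The neighbour of v in the direction of w, for w <> v. *)
Definition toward (v w : comp C) : comp C :=
  odflt v [pick u | adj v u &&
    connect [rel x y | [&& adj x y, x != v & y != v]] u w].

(* The image of the i-th marked point under the map C -> v that contracts all
   the components other than v. *)
Definition image_at (v : comp C) (i : 'I_5) : K * K :=
  if on C i == v then pt C i else node v (toward v (on C i)).

(* Forget the marked points of index > m and stabilize: v is the component that
   carries the marked point of index m in the resulting curve. *)
Definition carries (m : 'I_5) (v : comp C) : Prop :=
  (forall i : 'I_5, (i < m)%N -> br (image_at v i) (image_at v m) != 0) /\
  (exists i j : 'I_5,
     [/\ (i < m)%N, (j < m)%N & br (image_at v i) (image_at v j) != 0]).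

(* With p_k the image of the marked points on v, this is
   (p_1 - p_j) / (p_(m+1) - p_j).  Rescaling the homogeneous coordinates of
   the marked points, or changing the coordinate of the line v, multiplies
   the values for all j by a common nonzero factor. *)
Definition psi_coord (m : 'I_5) (v : comp C) (j : 'I_5) : K :=
  br (image_at v ord0) (image_at v j) / br (image_at v m) (image_at v j).

(* On boundary curves phi is the morphism extending the formula for distinct
   points: its factors are the Kapranov maps given by psi_4 on the space of
   (p_1, ..., p_4) and by psi_5.  Each is the same formula read on the
   component carrying p_4 after p_5 is forgotten, resp. carrying p_5: with
   that point at infinity, it gives the differences p_1 - p_j, not all zero. *)
Definition phi_a (v : comp C) (i : 'I_2) : K :=
  psi_coord (@inord 4 3) v (@inord 4 i.+1).
Definition phi_b (v : comp C) (j : 'I_3) : K :=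
  psi_coord (@inord 4 4) v (@inord 4 j.+1).

(* t is a vector of homogeneous coordinates of the image of C in P^5. *)
Definition kappa_point (t : 'I_6 -> K) : Prop :=
  exists va vb : comp C,
    [/\ carries (@inord 4 3) va, carries (@inord 4 4) vb &
     exists2 c : K, c != 0 &
       forall (i : 'I_2) (j : 'I_3),
         t (@inord 5 (3 * i + j)) = c * (phi_a va i * phi_b vb j)].

End Embedding.

(* Isomorphic curves have the same image, so that curves stand here for the
   points of the moduli space. *)
Definition kappa_image (K : fieldType) (t : 'I_6 -> K) : Prop :=
  exists C : stable_curve K, kappa_point C t.

(** Ideals *)

Definition ideal_gen (n : nat) (K : fieldType) (S : {mpoly K[n]} -> Prop)
    (f : {mpoly K[n]}) : Prop :=
  exists (k : nat) (c g : 'I_k -> {mpoly K[n]}),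
    (forall i, S (g i)) /\ f = \sum_(i < k) c i * g i.

(* X is given by the homogeneous coordinate vectors of its points. *)
Definition homogeneous_ideal (n : nat) (K : fieldType)
    (X : ('I_n -> K) -> Prop) : {mpoly K[n]} -> Prop :=
  ideal_gen (fun f => (exists d, f \is d.-homog) /\
                      forall t, X t -> f.@[t] = 0).

Definition tvar (K : fieldType) (k : nat) : {mpoly K[6]} := 'X_(@inord 5 k).

(** The open stratum: on P^1 with five distinct points, phi is given by the
    defining formula. *)

Section Smooth.
Variables (K : fieldType) (p : 'I_5 -> K) (p_inj : injective p).

Let e : rel unit := fun _ _ => false.

Fact smooth_tree : is_tree e.
Proof.
by move=> [] []; exists [::]; split=> [|[|[] s] []].
Qed.

Fact smooth_pt_neq0 i : (p i, 1) != (0, 0) :> K * K.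
Proof. by rewrite xpair_eqE oner_eq0 andbF. Qed.

Fact smooth_pt_pt i j : i != j -> tt = tt -> br (p i, 1) (p j, 1) != 0.
Proof. by move=> ij _; rewrite /br /= mulr1 mul1r subr_eq0 (inj_eq p_inj). Qed.

Fact smooth_stable (v : unit) :
  (3 <= #|[set i : 'I_5 | tt == v]| + #|[set w : unit | e v w]|)%N.
Proof.
have -> : [set i : 'I_5 | tt == v] = setT by apply/setP=> i; rewrite !inE; case: v.
by rewrite cardsT card_ord.
Qed.

Definition smooth_curve : stable_curve K :=
  @StableCurve K unit e (fun _ _ => (0, 0)) (fun=> tt) (fun i => (p i, 1))
    (fun _ _ => erefl) (fun _ => erefl) smooth_tree smooth_pt_neq0
    (fun _ _ h => False_ind _ (notF h)) smooth_pt_pt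
    (fun _ _ h => False_ind _ (notF h))
    (fun _ _ _ h => False_ind _ (notF h)) smooth_stable.

Lemma smooth_psi_coord (m : 'I_5) (v : comp smooth_curve) (j : 'I_5) :
  psi_coord m v j = (p ord0 - p j) / (p m - p j).
Proof. by case: v; rewrite /psi_coord /image_at /br /= !mulr1 !mul1r. Qed.

Lemma smooth_carries (m : 'I_5) (v : comp smooth_curve) :
  (1 < m)%N -> carries m v.
Proof.
case: v => m_gt1; split=> [i im|].
  by rewrite /image_at; apply: smooth_pt_pt => //; apply: contraTneq im => ->; rewrite ltnn.
exists (@inord 4 0), (@inord 4 1); rewrite !inordK //; split=> //.
  exact: ltnW.
by rewrite /image_at; apply: smooth_pt_pt => //; rewrite -val_eqE /= !inordK.
Qed.

End Smooth.

(* Main.v *)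
Require Import Defs.
From mathcomp Require Import all_boot all_order all_algebra.
From mathcomp Require Import reals complex mpoly.
From mathcomp Require Import ring zify.

(** Write [a_0 : a_1] and [b_0 : b_1 : b_2] for the two factors of phi.  The
    last three quadrics are the Segre relations, and the first two become a_0 F
    and a_1 F when t_(3i+j) = a_i b_j, where
      F = a_0 b_1 (b_0 - b_2) - a_1 b_0 (b_1 - b_2).

    The quadrics vanish on the image ([kappa_quadrics_vanish]).  Only F = 0
    needs an argument.  Clearing denominators with the Pluecker relation, F = 0
    says that the cross-ratio of p_1, ..., p_4 is the same on the component used
    for a and on the one used for b ([phi_equation]).  Such an identity holds for
    any two components v, w of a stable curve ([image_at_cross_ratio]): every
    marked point is contracted on v to the node towards w, or on w to the node
    towards v, and in each of the resulting cases both sides agree.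

    Conversely, the quadrics generate the ideal ([vanishing_in_ideal]).  In the
    linear coordinates
      v_0 = t_1 - t_4 + t_5, v_1 = t_1 - t_2, v_2 = t_0, v_3 = t_1 - t_3,
      v_4 = t_4, w = t_1
    on P^5 the span of the five quadrics has the cyclically symmetric basis
      v_k v_(k+2) + w v_(k+1) - w^2   (k mod 5),
    in which w = 0 cuts the surface in a pentagon of lines.  Replacing
    v_k v_(k+2) by w^2 - w v_(k+1) raises the exponent of w, so every form is,
    modulo the quadrics, a combination of monomials in which no v_k v_(k+2)
    occurs ([homog_reducible]).  These remaining monomials are linearly
    independent on the surface ([normal_form_eq0]): it is parametrized by
      w = X Y, v_0 = X^2 Y, v_1 = X Y^2, v_2 = Y (1 - Y), v_3 = X + Y - 1,
      v_4 = X (1 - X),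
    and the lowest terms in X, Y of these polynomials are, after division by
    X Y, the rays (1,0), (0,1), (-1,0), (-1,-1), (0,-1) of a complete smooth
    fan.  A remaining monomial of degree d amounts to a lattice point, expressed
    in the smallest cone of that fan that contains it, so the lowest terms of
    these monomials are distinct.
    Along the curve X = s, Y = s^M with M large they even have distinct orders
    of vanishing at s = 0.  General points of this curve come from five distinct
    points of P^1 ([tpoint_kappa_image]), which is all that is used of the
    vanishing of a form on the image. *)

Set Implicit Arguments.
Unset Strict Implicit.
Unset Printing Implicit Defensive.

Import GRing.Theory.
Local Open Scope ring_scope.

(** * Ideals given by generators *)

Lemma ideal_gen_mem n (K : fieldType) (S : {mpoly K[n]} -> Prop) g :
  S g -> ideal_gen S g.
Proof.
move=> Sg; exists 1%N, (fun=> 1), (fun=> g); split=> //.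
by rewrite big_ord1 mul1r.
Qed.

Lemma ideal_gen0 n (K : fieldType) (S : {mpoly K[n]} -> Prop) : ideal_gen S 0.
Proof. by exists 0%N, (fun=> 0), (fun=> 0); split=> [[]//|]; rewrite big_ord0. Qed.

Lemma ideal_genD n (K : fieldType) (S : {mpoly K[n]} -> Prop) f g :
  ideal_gen S f -> ideal_gen S g -> ideal_gen S (f + g).
Proof.
move=> [k [c [h [Sh ->]]]] [l [c' [h' [Sh' ->]]]].
pose glue T (a : 'I_k -> T) (b : 'I_l -> T) i :=
  match split i with inl x => a x | inr y => b y end.
exists (k + l)%N, (glue _ c c'), (glue _ h h'); split.
  by move=> i; rewrite /glue; case: split.
rewrite big_split_ord /=; congr (_ + _); apply: eq_bigr => i _; rewrite /glue.
  by rewrite (unsplitK (inl i)).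
by rewrite (unsplitK (inr i)).
Qed.

Lemma ideal_genM n (K : fieldType) (S : {mpoly K[n]} -> Prop) p f :
  ideal_gen S f -> ideal_gen S (p * f).
Proof.
move=> [k [c [h [Sh ->]]]]; exists k, (fun i => p * c i), h; split=> //.
by rewrite mulr_sumr; apply: eq_bigr => i _; rewrite mulrA.
Qed.

Lemma ideal_genN n (K : fieldType) (S : {mpoly K[n]} -> Prop) f :
  ideal_gen S f -> ideal_gen S (- f).
Proof. by rewrite -mulN1r; apply: ideal_genM. Qed.

Lemma ideal_gen_sum n (K : fieldType) (S : {mpoly K[n]} -> Prop)
    (I : Type) (r : seq I) (P : pred I) (F : I -> {mpoly K[n]}) :
  (forall i, P i -> ideal_gen S (F i)) -> ideal_gen S (\sum_(i <- r | P i) F i).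
Proof.
by move=> SF; apply: big_ind => //; [apply: ideal_gen0 | apply: ideal_genD].
Qed.

Lemma ideal_gen_trans n (K : fieldType) (S S' : {mpoly K[n]} -> Prop) f :
  (forall g, S g -> ideal_gen S' g) -> ideal_gen S f -> ideal_gen S' f.
Proof.
move=> SS' [k [c [h [Sh ->]]]]; apply: ideal_gen_sum => i _.
exact/ideal_genM/SS'.
Qed.

(** * Cross-ratios on the components of a stable curve *)

Section Tree.
Variables (K : fieldType) (C : stable_curve K).
Implicit Types v w u x : Defs.comp C.

Definition avoiding v : rel (Defs.comp C) :=
  [rel x y | [&& adj x y, x != v & y != v]].

Lemma avoidingP v x p : x != v ->
  path (avoiding v) x p = path (@adj _ C) x p && (v \notin p).
Proof.
elim: p x => [|y p IHp] x xv //=; rewrite inE negb_or /avoiding /= xv /= (eq_sym v).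
by case: (eqVneq y v) => yv; rewrite ?andbF //= andbT IHp // andbA.
Qed.

(** Two such neighbours u would start two simple paths from v to x, and in a
    tree there is only one. *)
Lemma toward_eq v u x :
  adj v u -> connect (avoiding v) u x -> toward v x = u.
Proof.
move=> vu ux; rewrite /toward; case: pickP => [u' /andP[vu' u'x]|/(_ u)]; last first.
  by rewrite vu ux.
have simple z : adj v z -> connect (avoiding v) z x ->
    exists p, [/\ path (@adj _ C) v (z :: p), last v (z :: p) = x & uniq (v :: z :: p)].
  move=> vz /connectP[p zp ->]; case/shortenP: zp => p' zp' Up' _.
  have zv : z != v by apply: contraTneq vz => ->; rewrite adj_irr.
  move: zp'; rewrite avoidingP // => /andP[zp' vp'].
  by exists p'; rewrite /= vz zp' inE negb_or eq_sym zv vp' -andbA.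
have [p hp] := simple _ vu ux; have [p' hp'] := simple _ vu' u'x.
have [q [_ uniq_q]] := adj_tree v x.
by have := uniq_q _ hp; rewrite (uniq_q _ hp') => -[].
Qed.

(** If the path from v to x runs through w, then x and w lie on the same side
    of v; otherwise it can be prefixed by the path from w to v, so that x and v
    lie on the same side of w. *)
Lemma toward_dichotomy v w x : v != w ->
  (x != v /\ toward v x = toward v w) \/ (x != w /\ toward w x = toward w v).
Proof.
move=> vw; have [->|xv] := eqVneq x v; first by right.
have [->|xw] := eqVneq x w; first by left; split; rewrite // eq_sym.
have [p [[vp px Up] _]] := adj_tree v x.
have [wp|wp] := boolP (w \in p).
  left; split=> //; case: p vp px Up wp => [|u p] /=.
    by [].
  move=> /andP[vu up] px /andP[vNp Up] wp.
  have uv : u != v by move: vNp; rewrite inE negb_or eq_sym => /andP[].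
  have upv : path (avoiding v) u p.
    by rewrite avoidingP // up /=; move: vNp; rewrite inE negb_or => /andP[].
  rewrite (toward_eq vu (x := x)); last by apply/connectP; exists p.
  rewrite (toward_eq vu (x := w)) //.
  move: wp; rewrite inE => /predU1P[->|wp]; first exact: connect0.
  by case/path.splitP: wp upv => p1 p2; rewrite cat_path => /andP[p1P _];
    apply/connectP; exists (rcons p1 w); rewrite ?last_rcons.
right; split=> //.
have [q [[wq qv Uq] _]] := adj_tree w v.
case: q wq qv Uq => [|u q] /=; first by move=> _ wv; rewrite wv eqxx in vw.
move=> /andP[wu uq] qv /andP[wNq _].
have uw : u != w by move: wNq; rewrite inE negb_or eq_sym => /andP[].
have cuv : connect (avoiding w) u v.
  apply/connectP; exists q => //; rewrite avoidingP // uq /=.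
  by move: wNq; rewrite inE negb_or => /andP[].
rewrite (toward_eq wu cuv) (toward_eq wu) //; apply: connect_trans cuv _.
by apply/connectP; exists p => //; rewrite avoidingP // vp.
Qed.

Lemma image_at_dichotomy v w i : v != w ->
  image_at v i = node v (toward v w) \/ image_at w i = node w (toward w v).
Proof.
move=> /(toward_dichotomy (on C i))[] [ne eq]; [left|right];
  by rewrite /image_at (negbTE ne) eq.
Qed.

(** Contracting C to v or to w does not change the cross-ratio of four marked
    points; without denominators this makes sense for all collisions.  When v
    and w differ, let D_v and D_w be the nodes on them towards each other.  A
    marked point goes to D_v on v, or else to D_w on w.  If the points that go
    to D_v on v are i, l or j, k, both sides are the same product of brackets up
    to antisymmetry; otherwise each side contains the bracket of a node with
    itself. *)
Lemma image_at_cross_ratio v w i j k l :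
  let a n := image_at v n in let b n := image_at w n in
  br (a i) (a j) * br (a k) (a l) * (br (b i) (b k) * br (b j) (b l)) =
  br (a i) (a k) * br (a j) (a l) * (br (b i) (b j) * br (b k) (b l)).
Proof.
move=> a b; rewrite {}/a {}/b; have [->|vw] := eqVneq v w; first exact: mulrC.
by case: (image_at_dichotomy i vw) => ->; case: (image_at_dichotomy j vw) => ->;
  case: (image_at_dichotomy k vw) => ->; case: (image_at_dichotomy l vw) => ->;
  rewrite /br; ring.
Qed.
End Tree.

(** * The equations of the image *)

Lemma brC (K : fieldType) (x y : K * K) : br x y = - br y x.
Proof. by rewrite /br; ring. Qed.

(** With common denominator, this is the Pluecker relation for p, q, r, s. *)
Lemma div_brB (K : fieldType) (p q r s : K * K) : br r q != 0 -> br s q != 0 ->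
  br p r / br q r - br p s / br q s = br p q * br r s / (br q r * br q s).
Proof.
rewrite (brC r q) (brC s q) !oppr_eq0.
have <- : br p r * br q s - br p s * br q r = br p q * br r s.
  by rewrite /br; ring.
by move=> /negPf rq /negPf sq; field; rewrite ?rq ?sq.
Qed.

(** By [div_brB], b_0 - b_2 and b_1 - b_2 are multiples of the brackets of
    p_2, p_4 and of p_3, p_4 with a common factor; what remains is the equality
    of the cross-ratios of p_1, ..., p_4 on va and on vb. *)
Lemma phi_equation (K : fieldType) (C : stable_curve K) (va vb : Defs.comp C) :
    carries (@inord 4 3) va -> carries (@inord 4 4) vb ->
  let a := psi_coord (@inord 4 3) va in let b := psi_coord (@inord 4 4) vb in
  a (inord 1) * b (inord 2) * (b (inord 1) - b (inord 3)) =
  a (inord 2) * b (inord 1) * (b (inord 2) - b (inord 3)).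
Proof.
move=> [a_ne _] [b_ne _] a b.
have := image_at_cross_ratio va vb ord0 (inord 1) (inord 2) (inord 3).
have [x1 x2] : br (image_at va (inord 1)) (image_at va (inord 3)) != 0 /\
    br (image_at va (inord 2)) (image_at va (inord 3)) != 0.
  by split; apply: a_ne; rewrite !inordK.
have [y1 y2 y3] : [/\ br (image_at vb (inord 1)) (image_at vb (inord 4)) != 0,
    br (image_at vb (inord 2)) (image_at vb (inord 4)) != 0 &
    br (image_at vb (inord 3)) (image_at vb (inord 4)) != 0].
  by split; apply: b_ne; rewrite !inordK.
rewrite {}/a {}/b /psi_coord !div_brB //.
move: x1 x2 y1 y2 y3; rewrite !(brC _ (image_at _ (inord 4))) !oppr_eq0.
rewrite !(brC (image_at va (inord 3))).
move: (br (image_at va (inord 1)) _) (br (image_at va (inord 2)) _) => u1 u2.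
move: (br (image_at vb (inord 4)) (image_at vb (inord 1)))
  (br (image_at vb (inord 4)) (image_at vb (inord 2)))
  (br (image_at vb (inord 4)) (image_at vb (inord 3))) => w1 w2 w3.
set c := br _ (image_at vb ord0).
move: (br (image_at va ord0) _) (br (image_at va ord0) _) => p2 p1.
move: (br (image_at vb ord0) _) (br (image_at vb ord0) _) => q1 q2.
move: (br (image_at vb (inord 1)) _) (br (image_at vb (inord 2)) _) => r1 r2.
move=> u1_ne0 u2_ne0 w1_ne0 w2_ne0 w3_ne0 cross.
(* Both sides are the same multiple of the two sides of cross. *)
transitivity (c / (u1 * u2 * w1 * w2 * w3) * (p1 * u2 * (q2 * r1))).
  by field; rewrite oppr_eq0 u1_ne0 u2_ne0 w1_ne0 w2_ne0 w3_ne0.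
by rewrite cross; field; rewrite oppr_eq0 u1_ne0 u2_ne0 w1_ne0 w2_ne0 w3_ne0.
Qed.

Definition segre_coordinates (K : fieldType) (x : 'I_6 -> K)
    (a0 a1 b0 b1 b2 : K) : Prop :=
  [/\ x (inord 0) = a0 * b0, x (inord 1) = a0 * b1 & x (inord 2) = a0 * b2] /\
  [/\ x (inord 3) = a1 * b0, x (inord 4) = a1 * b1 & x (inord 5) = a1 * b2].

Lemma kappa_image_coordinates (K : fieldType) (x : 'I_6 -> K) : kappa_image x ->
  exists a0 a1 b0 b1 b2 : K, segre_coordinates x a0 a1 b0 b1 b2 /\
    a0 * b1 * (b0 - b2) = a1 * b0 * (b1 - b2).
Proof.
move=> [C [va [vb [a_ok b_ok [c _ xE]]]]].
pose a := psi_coord (@inord 4 3) va; pose b := psi_coord (@inord 4 4) vb.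
exists (c * a (inord 1)), (c * a (inord 2)), (b (inord 1)), (b (inord 2)), (b (inord 3)).
have rel := phi_equation a_ok b_ok.
split; last by rewrite -!(mulrA c) -/a -/b rel.
have E (i : 'I_2) (j : 'I_3) : x (inord (3 * i + j)) = c * a (inord i.+1) * b (inord j.+1).
  by rewrite xE mulrA.
have E' i j (lt_i2 : (i < 2)%N) (lt_j3 : (j < 3)%N) :
    x (inord (3 * i + j)) = c * a (inord i.+1) * b (inord j.+1).
  exact: (E (Ordinal lt_i2) (Ordinal lt_j3)).
split; split.
- exact: (E' 0 0)%N.
- exact: (E' 0 1)%N.
- exact: (E' 0 2)%N.
- exact: (E' 1 0)%N.
- exact: (E' 1 1)%N.
- exact: (E' 1 2)%N.
Qed.

Definition kappa_quadrics (K : fieldType) : seq {mpoly K[6]} :=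
  let t := @tvar K in
  [:: t 0%N * t 1%N - t 0%N * t 4%N + t 2%N * t 3%N - t 1%N * t 2%N;
      t 0%N * t 4%N - t 3%N * t 4%N + t 3%N * t 5%N - t 1%N * t 5%N;
      t 1%N * t 3%N - t 0%N * t 4%N;
      t 2%N * t 3%N - t 0%N * t 5%N;
      t 2%N * t 4%N - t 1%N * t 5%N].

Lemma kappa_quadrics_vanish (K : fieldType) (x : 'I_6 -> K) g :
  kappa_image x -> g \in kappa_quadrics K -> g.@[x] = 0.
Proof.
move=> /kappa_image_coordinates[a0 [a1 [b0 [b1 [b2 [[[x0 x1 x2] [x3 x4 x5]] rel]]]]]].
have E k : (tvar K k).@[x] = x (inord k) by rewrite /tvar mevalXU.
have rel0 : a0 * b1 * (b0 - b2) - a1 * b0 * (b1 - b2) = 0 by rewrite rel subrr.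
rewrite !inE => /or4P[|||/orP[]] /eqP->;
  rewrite !(mevalB, mevalD, mevalM) !E ?x0 ?x1 ?x2 ?x3 ?x4 ?x5; try by ring.
(* What remains are a_0 F and a_1 F. *)
- by rewrite -[RHS](mulr0 a0) -rel0; ring.
- by rewrite -[RHS](mulr0 a1) -rel0; ring.
Qed.

Lemma tvarM_homog (K : fieldType) i j : tvar K i * tvar K j \is 2.-homog.
Proof. by rewrite -mpolyXD dhomogX /= mdegD !mdeg1. Qed.

Lemma kappa_quadrics_homog (K : fieldType) g :
  g \in kappa_quadrics K -> g \is 2.-homog.
Proof.
by rewrite !inE => /or4P[|||/orP[]] /eqP->; rewrite !(rpredB, rpredD) // tvarM_homog.
Qed.

(** * Cyclic coordinates *)

Lemma forall_ord6 (P : 'I_6 -> Prop) :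
  P (inord 0) -> P (inord 1) -> P (inord 2) -> P (inord 3) -> P (inord 4) ->
  P (inord 5) -> forall i, P i.
Proof.
by move=> p0 p1 p2 p3 p4 p5 i; rewrite -(inord_val i);
  case: i => -[|[|[|[|[|[|//]]]]]].
Qed.

Lemma sum_ord6 (F : 'I_6 -> nat) :
  (\sum_i F i = F (inord 0) + F (inord 1) + F (inord 2) + F (inord 3) +
                F (inord 4) + F (inord 5))%N.
Proof.
rewrite !big_ord_recr big_ord0 /= add0n.
by do !congr (_ + _)%N; congr (F _); apply: val_inj; rewrite /= inordK.
Qed.

(** The six coordinates are placed on a pentagon: one on each of the five
    sides, numbered cyclically, and one in the center. *)
Definition side (k : nat) : 'I_6 := inord (k %% 5).
Definition center : 'I_6 := inord 5.

Definition pentagon_quadric (K : fieldType) (k : nat) : {mpoly K[6]} :=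
  'X_(side k) * 'X_(side k.+2) + 'X_center * 'X_(side k.+1) - 'X_center ^+ 2.

Definition pentagon_ideal (K : fieldType) : {mpoly K[6]} -> Prop :=
  ideal_gen (fun g => exists k : 'I_5, g = pentagon_quadric K k).

(** The forms t_0, ..., t_5 in v_0, ..., v_4, w. *)
Definition tforms (K : fieldType) : 6.-tuple {mpoly K[6]} :=
  let v := @tvar K in
  [tuple v 2%N; v 5%N; v 5%N - v 1%N; v 5%N - v 3%N; v 4%N; v 0%N + v 4%N - v 5%N].

(** The forms v_0, ..., v_4, w in t_0, ..., t_5. *)
Definition vforms (K : fieldType) : 6.-tuple {mpoly K[6]} :=
  let t := @tvar K in
  [tuple t 1%N - t 4%N + t 5%N; t 1%N - t 2%N; t 0%N; t 1%N - t 3%N; t 4%N; t 1%N].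

Lemma comp_mpolyA n k l (K : fieldType) (p : {mpoly K[n]})
    (lq : n.-tuple {mpoly K[k]}) (lr : k.-tuple {mpoly K[l]}) :
  (p \mPo lq) \mPo lr = p \mPo [tuple tnth lq i \mPo lr | i < n].
Proof.
rewrite (comp_mpolyEX p lq) (comp_mpolyEX p [tuple _ | _ < _]) raddf_sum /=.
apply: eq_bigr => m _; rewrite comp_mpolyZ !comp_mpolyX; congr (_ *: _).
rewrite rmorph_prod; apply: eq_bigr => i _.
by rewrite rmorphXn /= tnth_mktuple.
Qed.

Lemma tformsK (K : fieldType) (f : {mpoly K[6]}) :
  (f \mPo tforms K) \mPo vforms K = f.
Proof.
rewrite comp_mpolyA -[RHS]comp_mpoly_id; congr (f \mPo _).
apply: eq_from_tnth; apply: forall_ord6; rewrite !tnth_mktuple !(tnth_nth 0) !inordK //=;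
  rewrite ?(comp_mpolyB, comp_mpolyD) !comp_mpolyXU !inordK //= /tvar; ring.
Qed.

Lemma pentagon_quadric_vforms (K : fieldType) (k : 'I_5) :
  ideal_gen (fun g => g \in kappa_quadrics K) (pentagon_quadric K k \mPo vforms K).
Proof.
pose Q i := nth 0 (kappa_quadrics K) i.
have memQ i : (i < 5)%N -> ideal_gen (fun g => g \in kappa_quadrics K) (Q i).
  by move=> lti; apply: ideal_gen_mem; apply: mem_nth.
rewrite /pentagon_quadric !(rmorphB, rmorphD, rmorphM, rmorphXn) /=.
rewrite !comp_mpolyXU; case: k => [[|[|[|[|[|//]]]]] lt_k5] /=; rewrite !inordK //=.
- set q := (X in ideal_gen _ X); have -> : q = Q 0%N - Q 3%N by rewrite /q /Q /=; ring.
  by apply: ideal_genD; [|apply: ideal_genN]; apply: memQ.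
- set q := (X in ideal_gen _ X); have -> : q = Q 0%N - Q 2%N by rewrite /q /Q /=; ring.
  by apply: ideal_genD; [|apply: ideal_genN]; apply: memQ.
- set q := (X in ideal_gen _ X); have -> : q = - Q 2%N by rewrite /q /Q /=; ring.
  by apply: ideal_genN; apply: memQ.
- set q := (X in ideal_gen _ X); have -> : q = - Q 1%N - Q 2%N by rewrite /q /Q /=; ring.
  by apply: ideal_genD; apply: ideal_genN; apply: memQ.
- set q := (X in ideal_gen _ X); have -> : q = - Q 4%N by rewrite /q /Q /=; ring.
  by apply: ideal_genN; apply: memQ.
Qed.

(** * Normal forms modulo the quadrics *)

(** A monomial of this kind involves, besides w, at most two consecutive v_k:
    it corresponds to a lattice point of a cone of the fan. *)
Definition pentagon_face (m : 'X_{1..6}) : bool :=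
  [forall k : 'I_5, (m (side k) == 0%N) || (m (side k.+2) == 0%N)].

Definition normal_form (K : fieldType) d (r : {mpoly K[6]}) : Prop :=
  {in msupp r, forall m, mdeg m = d /\ pentagon_face m}.

Definition reducible (K : fieldType) d (g : {mpoly K[6]}) : Prop :=
  exists2 r, normal_form d r & pentagon_ideal (g - r).

Lemma reducibleD (K : fieldType) d (g h : {mpoly K[6]}) :
  reducible d g -> reducible d h -> reducible d (g + h).
Proof.
move=> [r r_nf gr] [s s_nf hs]; exists (r + s).
  by move=> m /msuppD_le; rewrite mem_cat => /orP[/r_nf|/s_nf].
by rewrite opprD addrACA; apply: ideal_genD.
Qed.

Lemma reducibleZ (K : fieldType) d c (g : {mpoly K[6]}) :
  reducible d g -> reducible d (c *: g).
Proof.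
move=> [r r_nf gr]; exists (c *: r); first by move=> m /msuppZ_le /r_nf.
by rewrite -scalerBr -mul_mpolyC; apply: ideal_genM.
Qed.

Lemma reducible_congr (K : fieldType) d (g h : {mpoly K[6]}) :
  pentagon_ideal (g - h) -> reducible d h -> reducible d g.
Proof.
move=> gh [r r_nf hr]; exists r => //.
by rewrite -[g - r](subrKA h); apply: ideal_genD.
Qed.

Lemma reducible0 (K : fieldType) d : reducible d (0 : {mpoly K[6]}).
Proof.
exists 0; first by move=> m; rewrite msupp0.
by rewrite subr0; apply: ideal_gen0.
Qed.

(** Each rewriting step replaces a product of two side variables by terms with
    at least one more factor w, and keeps the degree. *)
Lemma reducibleX (K : fieldType) (m : 'X_{1..6}) :
  reducible (mdeg m) ('X_[m] : {mpoly K[6]}).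
Proof.
have [n] := ubnP (mdeg m - m center); elim: n m => // n IHn m.
rewrite ltnS => le_mn; have [face_m|] := boolP (pentagon_face m).
  exists 'X_[m]; first by move=> m'; rewrite msuppX inE => /eqP->.
  by rewrite subrr; apply: ideal_gen0.
rewrite negb_forall => /existsP[k]; rewrite negb_or -!lt0n => /andP[mk mk2].
have side_inj : side k != side k.+2.
  rewrite /side -val_eqE /= !inordK; try lia.
have side_center i : (side i == center) = false.
  rewrite /side /center -val_eqE /= !inordK //; lia.
pose m' := (m - U_(side k) - U_(side k.+2))%MM.
have mE : m = (m' + U_(side k) + U_(side k.+2))%MM.
  apply/mnmP => i; rewrite /m' !(mnmBE, mnmDE) !mnm1E.
  case: eqP => [<-|_]; first by rewrite eq_sym (negbTE side_inj); lia.
  by case: eqP => [<-|_]; lia.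
pose m1 := (m' + U_(center) + U_(side k.+1))%MM.
pose m2 := (m' + U_(center) + U_(center))%MM.
have deg1 : mdeg m1 = mdeg m by rewrite mE /m1 !mdegD !mdeg1.
have deg2 : mdeg m2 = mdeg m by rewrite mE /m2 !mdegD !mdeg1.
have le_center (i : 'X_{1..6}) : (i center <= mdeg i)%N.
  by rewrite mdegE (bigD1 center) //= leq_addr.
have c0 : m center = m' center by rewrite mE !mnmDE !mnm1E !side_center !addn0.
have c1 : m1 center = (m center).+1.
  by rewrite c0 /m1 !mnmDE !mnm1E side_center eqxx addn0 addn1.
have c2 : m2 center = (m center).+2.
  by rewrite c0 /m2 !mnmDE !mnm1E eqxx !addn1.
have XE : 'X_[m] = 'X_[m'] * pentagon_quadric K k + (-1 *: 'X_[m1] + 'X_[m2]).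
  rewrite mE /m1 /m2 /pentagon_quadric !mpolyXD scaleN1r; ring.
apply: (reducible_congr (h := -1 *: 'X_[m1] + 'X_[m2])).
  rewrite XE addrK; apply: ideal_genM; apply: ideal_gen_mem; by exists k.
have := le_center m1; have := le_center m2 => ? ?.
apply: reducibleD; first (apply: reducibleZ; rewrite -deg1).
  by apply: IHn; lia.
by rewrite -deg2; apply: IHn; lia.
Qed.

Lemma homog_reducible (K : fieldType) d (g : {mpoly K[6]}) :
  g \is d.-homog -> reducible d g.
Proof.
move=> /dhomogP g_homog; rewrite [g]mpolyE big_seq.
apply: big_ind; [exact: reducible0 | exact: reducibleD |] => m /g_homog /= <-.
exact/reducibleZ/reducibleX.
Qed.

(** * Independence of the normal forms *)

(** If the variables are replaced by polynomials of order e at 0, a relation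
    between monomials that acquire distinct orders is impossible: the term of
    least order cannot cancel. *)
Lemma mmap_valuation_eq0 n (K : fieldType) (e : 'I_n -> nat) (u : 'I_n -> {poly K})
    (r : {mpoly K[n]}) :
    (forall i, (u i).[0] != 0) ->
    {in msupp r &, injective (fun m : 'X_{1..n} => \sum_i e i * m i)%N} ->
  mmap polyC (fun i => 'X^(e i) * u i) r = 0 -> r = 0.
Proof.
move=> u0 e_inj r0; apply/eqP; rewrite -msupp_eq0 -size_eq0 -leqn0 leqNgt.
apply/negP => supp_gt0.
pose wt (m : 'X_{1..n}) := (\sum_i e i * m i)%N.
pose w0 := nth 0%MM (msupp r) 0.
have [m0 rm0 m0_min] : exists2 m0, m0 \in msupp r &
    forall m, m \in msupp r -> (wt m0 <= wt m)%N.
  have ex : exists k, k \in map wt (msupp r).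
    by exists (wt w0); apply/map_f/mem_nth.
  case: (ex_minnP ex) => _ /mapP[m0 rm0 ->] min_m0.
  by exists m0 => // m rm; apply/min_m0/map_f.
have monomialE m : mmap1 (fun i => 'X^(e i) * u i) m =
    'X^(wt m) * \prod_i u i ^+ m i.
  rewrite /mmap1 /wt -prodrXr -big_split /=; apply: eq_bigr => i _.
  by rewrite exprMn exprM.
have := congr1 (fun p : {poly K} => p`_(wt m0)) r0.
rewrite /mmap coef_sum coef0 (bigD1_seq m0) ?msupp_uniq //= big1_seq => [|m /andP[nm rm]].
  rewrite addr0 coefCM monomialE coefXnM ltnn subnn => /eqP.
  rewrite mulf_eq0 mcoeff_eq0 rm0 /= -horner_coef0 horner_prod.
  by case/prodf_eq0 => i _; rewrite horner_exp expf_eq0 (negbTE (u0 i)) andbF.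
rewrite coefCM monomialE coefXnM ltn_neqAle m0_min // andbT.
have -> : wt m0 != wt m by apply: contra_neq nm => /e_inj->.
by rewrite mulr0.
Qed.

(** * Points of the open stratum *)

(** The parametrization of the surface in the cyclic coordinates, and in the
    original ones, where it is the Segre image of ([Y : 1 - X],
    [1 - Y : X : X (1 - Y)]). *)
Definition vpoint (K : fieldType) (X Y : K) (i : 'I_6) : K :=
  nth 0 [:: X ^+ 2 * Y; X * Y ^+ 2; Y * (1 - Y); X + Y - 1; X * (1 - X); X * Y] i.

Definition tpoint (K : fieldType) (X Y : K) (i : 'I_6) : K :=
  nth 0 [:: Y * (1 - Y); Y * X; Y * (X * (1 - Y));
            (1 - X) * (1 - Y); (1 - X) * X; (1 - X) * (X * (1 - Y))] i.

Lemma tforms_vpoint (K : fieldType) (X Y : K) i :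
  (tnth (tforms K) i).@[vpoint X Y] = tpoint X Y i.
Proof.
move: i; apply: forall_ord6; rewrite (tnth_nth 0) /tpoint !inordK //=;
  rewrite ?(mevalB, mevalD) !mevalXU /vpoint !inordK //=; ring.
Qed.

Lemma pentagon_ideal_vpoint (K : fieldType) (X Y : K) g :
  pentagon_ideal g -> g.@[vpoint X Y] = 0.
Proof.
move=> [n [c [h [h_quad ->]]]]; rewrite raddf_sum big1 // => i _ /=.
rewrite mevalM; suff -> : (h i).@[vpoint X Y] = 0 by rewrite mulr0.
have [k ->] := h_quad i.
rewrite /pentagon_quadric expr2 !(mevalB, mevalD, mevalM) !mevalXU /vpoint.
by case: k => [[|[|[|[|[|//]]]]] ?]; rewrite !inordK //=; ring.
Qed.

(** The points are chosen in the coordinate z = 1/p, which puts p_5 at infinity: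
    there z_1 = 1 and z_(j+2) = 1 - b_j with b = (1 - Y, X, X (1 - Y)), so that
    the differences z_1 - z_(j+2) are the required b_j. *)
Lemma tpoint_kappa_image (K : fieldType) (X Y : K) :
    [/\ X != 0, Y != 0, 1 - X != 0 & 1 - Y != 0] ->
    1 - X - Y != 0 -> 1 - X + X * Y != 0 ->
  kappa_image (tpoint X Y).
Proof.
move=> [X0 Y0 X1 Y1] XY1 Z0.
pose zs := [:: 1; Y; 1 - X; 1 - X + X * Y; 0].
pose p (i : 'I_5) := (nth 0 zs i)^-1.
have neq (a b c : K) : c != 0 -> c = a - b -> (a == b) = false.
  by move=> c_neq0 cE; apply/negbTE; rewrite -subr_eq0 -cE.
have uniq_zs : uniq zs.
  rewrite /= !inE oner_eq0 (negbTE Y0) (negbTE X1) (negbTE Z0).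
  rewrite (neq 1 Y _ Y1) // (neq 1 (1 - X) _ X0); last by ring.
  rewrite (neq 1 (1 - X + X * Y) (X * (1 - Y))) ?mulf_neq0 //; last by ring.
  rewrite (neq Y (1 - X) (- (1 - X - Y))) ?oppr_eq0 //; last by ring.
  rewrite (neq Y (1 - X + X * Y) (- ((1 - X) * (1 - Y)))) ?oppr_eq0 ?mulf_neq0 //; last by ring.
  by rewrite (neq (1 - X) (1 - X + X * Y) (- (X * Y))) ?oppr_eq0 ?mulf_neq0 //; ring.
have p_inj : injective p.
  by move=> i j /invr_inj/eqP; rewrite nth_uniq // => /eqP; apply: val_inj.
exists (smooth_curve p_inj), tt, tt; split; try by apply: smooth_carries; rewrite inordK.
pose Z : K := 1 - X + X * Y; have {}Z0 : Z != 0 by [].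
have ratio (z : K) : z != 0 -> z - Z != 0 ->
    (1^-1 - z^-1) / (Z^-1 - z^-1) = Z * (z - 1) / (z - Z).
  by move=> z0 zZ; field; rewrite zZ z0 Z0 oner_eq0.
have a0 : (1^-1 - Y^-1) / (Z^-1 - Y^-1) = Z / (1 - X).
  have YZ : Y - Z = - (1 - X) * (1 - Y) by rewrite /Z; ring.
  by rewrite ratio ?YZ ?mulf_neq0 ?oppr_eq0 //; field; rewrite oppr_eq0 X1 Y1.
have a1 : (1^-1 - (1 - X)^-1) / (Z^-1 - (1 - X)^-1) = Z / Y.
  have XZ : 1 - X - Z = - (X * Y) by rewrite /Z; ring.
  by rewrite ratio ?XZ ?oppr_eq0 ?mulf_neq0 //; field; rewrite oppr_eq0 mulf_neq0 ?Y0.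
have b (z : K) : z != 0 -> (1^-1 - z^-1) / (0^-1 - z^-1) = 1 - z.
  by move=> z0; rewrite invr0; field; rewrite ?oppr_eq0 ?z0 ?oner_eq0.
exists (Y * (1 - X) / Z); first by rewrite !mulf_neq0 ?invr_neq0.
move=> i j; rewrite /phi_a /phi_b !smooth_psi_coord /p.
have tE (a c : K) : a != 0 -> Z / a * c * (Y * (1 - X) / Z) = c * (Y * (1 - X) / a).
  by move=> a_neq0; field; rewrite Z0 a_neq0.
rewrite mulrC.
by case: i => [[|[|//]] ?]; case: j => [[|[|[|//]]] ?];
  rewrite /tpoint !inordK //= -/Z ?a0 ?a1 b // tE // /Z; field; rewrite ?X1 ?Y0.
Qed.

(** The weights are the orders at s = 0 of the coordinates of the point with
    X = s, Y = s^M.  As M exceeds the exponents that occur in degree d, the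
    weight determines the exponents A of X and B of Y separately.  Together with
    the degree, these determine a monomial supported on a cone of the fan. *)
Lemma normal_form_weight_inj (K : fieldType) d (r : {mpoly K[6]}) M :
    (d.*2 < M)%N ->
    normal_form d r ->
  let e (i : 'I_6) := nth 0%N [:: M.+2; M.*2.+1; M; 0; 1; M.+1]%N i in
  {in msupp r &, injective (fun m : 'X_{1..6} => \sum_i e i * m i)%N}.
Proof.
move=> lt_dM r_nf e m n /r_nf[deg_m /forallP face_m] /r_nf[deg_n /forallP face_n].
have face (l : 'X_{1..6}) :
    (forall k : 'I_5, (l (side k) == 0%N) || (l (side k.+2) == 0%N)) ->
  [/\ l (inord 0) = 0 \/ l (inord 2) = 0, l (inord 1) = 0 \/ l (inord 3) = 0,
      l (inord 2) = 0 \/ l (inord 4) = 0, l (inord 3) = 0 \/ l (inord 0) = 0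
    & l (inord 4) = 0 \/ l (inord 1) = 0]%N.
  move=> f; split.
  - by have /orP[] := f (inord 0); rewrite /side inordK // => /eqP; [left|right].
  - by have /orP[] := f (inord 1); rewrite /side inordK // => /eqP; [left|right].
  - by have /orP[] := f (inord 2); rewrite /side inordK // => /eqP; [left|right].
  - by have /orP[] := f (inord 3); rewrite /side inordK // => /eqP; [left|right].
  - by have /orP[] := f (inord 4); rewrite /side inordK // => /eqP; [left|right].
have [f1 f2 f3 f4 f5] := face _ face_m; have [g1 g2 g3 g4 g5] := face _ face_n.
move: deg_m deg_n; rewrite !mdegE !sum_ord6 /e !inordK //=.
move: f1 f2 f3 f4 f5 g1 g2 g3 g4 g5.
have eq_mn : m (inord 0) = n (inord 0) -> m (inord 1) = n (inord 1) ->
    m (inord 2) = n (inord 2) -> m (inord 3) = n (inord 3) ->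
    m (inord 4) = n (inord 4) -> m (inord 5) = n (inord 5) -> m = n.
  by move=> *; apply/mnmP; apply: forall_ord6.
move: eq_mn.
move: (m (inord 0)) (m (inord 1)) (m (inord 2)) (m (inord 3)) (m (inord 4)) (m (inord 5)).
move=> m0 m1 m2 m3 m4 m5.
move: (n (inord 0)) (n (inord 1)) (n (inord 2)) (n (inord 3)) (n (inord 4)) (n (inord 5)).
move=> n0 n1 n2 n3 n4 n5 eq_mn f1 f2 f3 f4 f5 g1 g2 g3 g4 g5 deg_m deg_n.
pose A := (2 * m0 + m1 + m4 + m5)%N; pose B := (m0 + 2 * m1 + m2 + m5)%N.
pose A' := (2 * n0 + n1 + n4 + n5)%N; pose B' := (n0 + 2 * n1 + n2 + n5)%N.
move=> eq_wt.
have {eq_wt} : (B * M + A = B' * M + A')%N by rewrite /A /A' /B /B'; nia.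
have AM : (A < M)%N by rewrite /A; lia.
have AM' : (A' < M)%N by rewrite /A'; lia.
move=> eqBA.
have eqA : A = A'.
  by have := congr1 (modn^~ M) eqBA; rewrite !modnMDl !modn_small.
have eqB : B = B'.
  have := congr1 (divn^~ M) eqBA; rewrite !divnMDl ?(leq_ltn_trans _ lt_dM) //.
  by rewrite !divn_small // !addn0.
rewrite /A /A' in eqA; rewrite /B /B' in eqB.
by apply: eq_mn; lia.
Qed.

Lemma horner_mmap_polyC n (K : fieldType) (c : 'I_n -> {poly K}) (r : {mpoly K[n]}) s :
  (mmap polyC c r).[s] = r.@[fun i => (c i).[s]].
Proof.
rewrite /mmap horner_sum mevalE; apply: eq_bigr => m _.
rewrite hornerM hornerC /mmap1 horner_prod; congr (_ * _).
by apply: eq_bigr => i _; rewrite horner_exp.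
Qed.

(** A normal form that vanishes at the points of the open stratum vanishes at
    all but finitely many points of the curve X = s, Y = s^M, hence identically
    along it; as its monomials have distinct orders at s = 0, it is zero. *)
Lemma normal_form_eq0 (K : fieldType) d (r : {mpoly K[6]}) :
    (forall p : {poly K}, (forall s, p.[s] = 0) -> p = 0) ->
    normal_form d r ->
    (forall X Y : K, kappa_image (tpoint X Y) -> r.@[vpoint X Y] = 0) ->
  r = 0.
Proof.
move=> K_inf r_nf r_van; pose M := d.*2.+1.
pose e (i : 'I_6) := nth 0%N [:: M.+2; M.*2.+1; M; 0; 1; M.+1]%N i.
pose u (i : 'I_6) : {poly K} :=
  nth 0 [:: 1; 1; 1 - 'X^M; 'X + 'X^M - 1; 1 - 'X; 1] i.
apply: (@mmap_valuation_eq0 _ _ e u).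
- by apply: forall_ord6; rewrite /u inordK //= !hornerE ?expr0n /=
    ?(subr0, add0r) ?oppr_eq0 oner_eq0.
- exact: (normal_form_weight_inj (ltnSn _) r_nf).
set p := mmap _ _ _.
(* The parameters for which the five points are not distinct. *)
pose bad : {poly K} := 'X * 'X^M * (1 - 'X) * (1 - 'X^M) * (1 - 'X - 'X^M) *
  (1 - 'X + 'X * 'X^M).
have bad_neq0 : bad != 0.
  have at0 (q : {poly K}) : q.[0] = 1 -> q != 0.
    by move=> q0; apply: contra_eq_neq q0 => ->; rewrite horner0 eq_sym oner_eq0.
  rewrite !mulf_neq0 ?polyX_eq0 ?expf_neq0 ?polyX_eq0 //; apply: at0;
    by rewrite !hornerE /= ?expr0n /= ?mul0r ?subr0 ?addr0.
suff /eqP : p * bad = 0 by rewrite mulf_eq0 (negbTE bad_neq0) orbF => /eqP.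
apply: K_inf => s; rewrite hornerM; have [->|] := eqVneq bad.[s] 0; first by rewrite mulr0.
rewrite /bad !hornerE => /=; rewrite !mulf_eq0 !negb_or -!andbA.
move=> /and5P[X0 Y0 X1 Y1 /andP[XY1 Z0]].
rewrite /p horner_mmap_polyC.
have := r_van s (s ^+ M) (tpoint_kappa_image _ XY1 Z0).
rewrite (_ : r.@[_] = r.@[vpoint s (s ^+ M)]) => [->|]; rewrite ?mul0r //.
apply: meval_eq; apply: forall_ord6; rewrite /e /u /vpoint !inordK //= !hornerE //.
- by rewrite -exprD.
- by rewrite exprS -addnn exprD mulrA.
Qed.

(** * The ideal of the image *)

Lemma tforms_homog (K : fieldType) d (f : {mpoly K[6]}) :
  f \is d.-homog -> f \mPo tforms K \is d.-homog.
Proof.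
move=> /dhomogP f_homog; rewrite comp_mpolyEX big_seq rpred_sum // => m /f_homog /= <-.
rewrite rpredZ // comp_mpolyX.
have v_homog k : tvar K k \is 1.-homog by rewrite dhomogX /= mdeg1.
have T_homog i : tnth (tforms K) i \is 1.-homog.
  by move: i; apply: forall_ord6; rewrite (tnth_nth 0) inordK //= ?(rpredB, rpredD) ?v_homog.
rewrite mdegE; elim/big_rec2: _ => [|i p q _ q_homog]; first exact: dhomog1.
by apply: dhomogM => //; have := dhomogMn (m i) (T_homog i); rewrite mul1n.
Qed.

(** Modulo the quadrics f is a normal form, which vanishes wherever f does. *)
Lemma vanishing_in_ideal (K : fieldType) d (f : {mpoly K[6]}) :
    (forall p : {poly K}, (forall s, p.[s] = 0) -> p = 0) ->
    f \is d.-homog -> (forall x, kappa_image x -> f.@[x] = 0) ->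
  ideal_gen (fun g => g \in kappa_quadrics K) f.
Proof.
move=> K_inf f_homog f_van.
have [r r_nf fr] := homog_reducible (tforms_homog f_homog).
have r0 : r = 0.
  apply: normal_form_eq0 r_nf _ => // X Y XY.
  have /eqP := pentagon_ideal_vpoint X Y fr.
  rewrite mevalB subr_eq0 comp_mpoly_meval => /eqP <-.
  by rewrite -[RHS](f_van _ XY); apply: meval_eq => i; rewrite tforms_vpoint.
move: fr; rewrite r0 subr0 => -[n [c [h [h_quad fE]]]].
rewrite -[f]tformsK fE raddf_sum /=; apply: ideal_gen_sum => i _.
rewrite rmorphM; apply: ideal_genM; have [k ->] := h_quad i.
exact: pentagon_quadric_vforms.
Qed.

(** The hypothesis on polynomials says that K is infinite, so that the points
    of the image with coordinates in K determine its equations. *)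
Theorem kappa_ideal (K : fieldType) (f : {mpoly K[6]}) :
    (forall p : {poly K}, (forall s, p.[s] = 0) -> p = 0) ->
  homogeneous_ideal (@kappa_image K) f <->
  ideal_gen (fun g => g \in kappa_quadrics K) f.
Proof.
move=> K_inf; split; apply: ideal_gen_trans => g.
  by move=> [[d g_homog] g_van]; apply: vanishing_in_ideal g_homog g_van.
move=> g_quad; apply: ideal_gen_mem; split; first by exists 2; apply: kappa_quadrics_homog.
by move=> x x_im; apply: kappa_quadrics_vanish g_quad.
Qed.

Lemma numField_poly_eq0 (K : numFieldType) (p : {poly K}) :
  (forall s, p.[s] = 0) -> p = 0.
Proof.
move=> p0; apply: (@roots_geq_poly_eq0 _ p [seq i%:R | i <- iota 0 (size p)]).
- by apply/allP=> s _; apply/rootP.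
- by rewrite map_inj_uniq ?iota_uniq //; apply: Num.Theory.mulrIn; rewrite oner_eq0.
- by rewrite size_map size_iota.
Qed.

Theorem corollary1p3 (R : realType) :
  let t := tvar (R[i] : fieldType) in
  forall f : {mpoly R[i][6]},
    homogeneous_ideal (@kappa_image (R[i] : fieldType)) f <->
    ideal_gen (fun g => g \in
      [:: t 0%N * t 1%N - t 0%N * t 4%N + t 2%N * t 3%N - t 1%N * t 2%N;
          t 0%N * t 4%N - t 3%N * t 4%N + t 3%N * t 5%N - t 1%N * t 5%N;
          t 1%N * t 3%N - t 0%N * t 4%N;
          t 2%N * t 3%N - t 0%N * t 5%N;
          t 2%N * t 4%N - t 1%N * t 5%N]) f.
Proof. by move=> t f; apply: kappa_ideal; apply: numField_poly_eq0. Qed.
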